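(* For every $d, \alpha > 0$ there exists a constant $C := C(d, \alpha) > 0$ such that the following holds. Let $p := p(n) \geq C/n$ and $r = (1 + \alpha) n$. For each $n$, let $G = G_n$ be any $n$-vertex graph with minimum degree $\delta(G) \geq dn$. Let $R \sim \mathbb{G}(n,p)$ be a binomial random graph on the same vertex set as $G$, and colour each edge of $G \cup R$ with a colour chosen independently and uniformly at random from $[r]$. Then, asymptotically almost surely (i.e. with probability tending to $1$ as $n \to \infty$), the resulting edge-coloured graph $G \cup R$ contains a rainbow Hamilton cycle.
   Context: A Hamilton cycle (or any subgraph) is rainbow if all of its edges receive distinct colours; a rainbow Hamilton cycle on $n$ vertices thus uses $n$ distinct colours. $\mathbb{G}(n,p)$ denotes the random graph on $n$ labelled vertices in which each pair is an edge independently with probability $p$. The probability space is the joint randomness of $R$ and of the colouring. *)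

(* Defs.v *)
From mathcomp Require Import all_boot all_order all_algebra.
From mathcomp Require Import all_classical all_reals all_analysis.

Set Implicit Arguments.
Unset Strict Implicit.
Unset Printing Implicit Defensive.

Import Order.TTheory GRing.Theory Num.Theory.
Import numFieldNormedType.Exports.

Local Open Scope ring_scope.

(* A finite simple graph on V is a set of two-element subsets of V, so that
   the union of two graphs on V is the union of sets. *)
Definition vpair (V : finType) := {e : {set V} | #|e| == 2%N}.
Definition sgraph (V : finType) := {set vpair V}.

Definition adj (V : finType) (E : sgraph V) : rel V :=
  fun x y => [exists e in E, val e == [set x; y]].

Definition degree (V : finType) (E : sgraph V) (v : V) : nat :=
  #|[set e in E | v \in val e]|.

(* Degrees are smaller than #|V|, so the neutral element #|V| only matters
   when V is empty. *)
Definition min_degree (V : finType) (E : sgraph V) : nat :=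
  \big[minn/#|V|]_(v : V) degree E v.

Definition hamilton_cycle (V : finType) (E : sgraph V) (s : seq V) : bool :=
  [&& (3 <= #|V|)%N, size s == #|V| & ucycleb (adj E) s].

Definition colouring (V : finType) (E : sgraph V) (r : nat) :=
  {ffun {e : vpair V | e \in E} -> 'I_r}.

Definition on_cycle (V : finType) (s : seq V) (e : vpair V) : bool :=
  [exists x in s, val e == [set x; next s x]].

Definition rainbow (V : finType) (E : sgraph V) (r : nat)
    (c : colouring E r) (s : seq V) : bool :=
  dinjectiveb c [pred e : {e : vpair V | e \in E} | on_cycle s (val e)].

Definition has_rainbow_hamilton_cycle (V : finType) (r : nat) (E : sgraph V)
    (c : colouring E r) : bool :=
  [exists s : #|V|.-tuple V, hamilton_cycle E s && rainbow c s].

(* The law of G(n,p): the edge indicators are independent Bernoulli(p). *)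
Definition gnp_weight (R : realType) (V : finType) (p : R) (E : sgraph V) : R :=
  \prod_(e : vpair V) (if e \in E then p else 1 - p).

(* The edges of E get independent uniform colours. *)
Definition colouring_weight (R : realType) (V : finType) (E : sgraph V)
    (r : nat) (c : colouring E r) : R :=
  \prod_(e : {e : vpair V | e \in E}) r%:R^-1.

(* Probability that the event A holds for G :|: H with its colouring, where H
   has the law of G(n,p) and, given H, the edges of G :|: H are coloured
   uniformly and independently. *)
Definition perturbed_prob (R : realType) (V : finType) (p : R) (G : sgraph V)
    (r : nat) (A : forall E : sgraph V, colouring E r -> bool) : R :=
  \sum_(H : sgraph V) gnp_weight p H *
    \sum_(c : colouring (G :|: H) r | A (G :|: H) c) colouring_weight R c.

(* Main.v *)
(* Reserve a set D0 of about alpha n / 2 colours. With high probability: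
   (1) any two disjoint vertex sets A, B of size k = Theta(n) are joined by an
   edge whose colour avoids D0 and any prescribed set D of at most n colours;
   (2) every vertex sees at least 11 k colours of D0 on its edges.
   Both are union bounds; (1) uses only the random edges and wins over the
   exponentially many choices of A, B, D when C is large, (2) uses only the
   edges of G and wins when k / n is small.
   Given (1) and (2) the rest is deterministic. A depth-first search through
   colours outside D0 finds a rainbow path missing fewer than 2 k vertices, and
   an edge between its first k and its last k vertices closes it up to a rainbow
   cycle missing fewer than 4 k vertices. A missing vertex u is inserted by
   removing the edges x x', y y' that leave two neighbours x, y of u along the
   cycle, and adding x u, u y, coloured from D0, and x' y', coloured outside D0:
   (1), applied to the successors of the usable neighbours of u, provides x' y'. *)
Require Import Defs.
From mathcomp Require Import all_boot all_order all_algebra.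
From mathcomp Require Import all_classical all_reals all_analysis.
From mathcomp Require Import zify ring lra.

Set Implicit Arguments.
Unset Strict Implicit.
Unset Printing Implicit Defensive.

Import Order.TTheory GRing.Theory Num.Theory.
Import numFieldNormedType.Exports.

(** * Rainbow paths and cycles in a joined coloured graph *)

Section RainbowCycles.
Import mathcomp.boot.fintype mathcomp.boot.finset.
Local Open Scope nat_scope.

Lemma pairmap_rev (T S : Type) (f : T -> T -> S) (x : T) (p : seq T) :
  (forall y z, f y z = f z y) ->
  pairmap f (last x p) (rev (belast x p)) = rev (pairmap f x p).
Proof.
move=> fC; elim: p x => //= y p IHp x.
rewrite [in LHS]rev_cons -[in LHS]cats1 pairmap_cat IHp rev_cons -cats1 /=.
congr (_ ++ [:: _]); rewrite fC; congr (f x _).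
by case: p {IHp} => //= z p; rewrite rev_cons last_rcons.
Qed.

Variables (V K : finType) (h : rel V) (col : V -> V -> K).
Hypothesis colC : forall x y, col x y = col y x.
Hypothesis hC : symmetric h.

Definition path_colours (q : seq V) : seq K :=
  if q is x :: p then pairmap col x p else [::].

Definition rainbow_path (q : seq V) : bool :=
  if q is x :: p then [&& path h x p, uniq q & uniq (pairmap col x p)]
  else true.

Lemma rainbow_path_infix (q1 q2 p : seq V) (x : V) :
  rainbow_path (q1 ++ x :: p ++ q2) ->
  rainbow_path (x :: p) /\
  {subset pairmap col x p <= path_colours (q1 ++ x :: p ++ q2)}.
Proof.
have init z : [&& path h x (p ++ q2), uniq z & uniq (pairmap col x (p ++ q2))] ->
    z = x :: p ++ q2 -> rainbow_path (x :: p).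
  case/and3P=> + + + def_z; rewrite {}def_z cat_path -cat_cons cat_uniq pairmap_cat.
  by rewrite cat_uniq /= => /andP[-> _] /andP[-> _] /andP[-> _].
case: q1 => [|z q1] /= /and3P[hp up cp].
  split; last by move=> a pa; rewrite pairmap_cat mem_cat pa.
  by apply: (init (x :: p ++ q2)) => //; apply/and3P.
split; last first.
  by move=> a pa; rewrite pairmap_cat /= pairmap_cat mem_cat inE mem_cat pa !orbT.
apply: (init (x :: p ++ q2)) => //; apply/and3P; split.
- by move: hp; rewrite cat_path => /andP[_ /= /andP[]].
- by move: up => /andP[_]; rewrite cat_uniq => /and3P[].
- by move: cp; rewrite pairmap_cat cat_uniq => /and3P[_ _ /= /andP[]].
Qed.

(* Colours are never released when the search backtracks, so one colour set D
   witnesses all the failed extensions, and it has at most one colour for each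
   vertex that has left U. *)
Lemma rainbow_dfs (t : nat) : t <= #|V| ->
  exists (S U : {set V}) (q : seq V) (D : {set K}),
    [/\ [/\ U =i [predC [predU S & q]], [disjoint S & q], rainbow_path q,
            #|S| + #|V| = t + #|U| & #|D| + #|U| <= #|V|],
        {subset path_colours q <= D} &
        forall x y, x \in S -> y \in U -> h x y -> col x y \in D].
Proof.
(* Each move takes one vertex from [U] onto the path or retires the head of the path to [S], so
   [t = 2 * #|S| + size q]. Since [S], [U] and [q] partition [V], this is the stated equation; it
   forces [U] to be nonempty as long as [t < #|V|]. *)
elim: t => [_|t IHt lt_t].
  exists set0, setT, [::], set0; split=> //; last by move=> x y; rewrite inE.
  split=> //; rewrite ?cards0 ?cardsT ?add0n //; first by move=> x; rewrite !inE.
  by apply/pred0P=> x /=; rewrite inE.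
have [S [U [q [D [[defU disSq rq eqt leD] sub_qD noSU]]]]] := IHt (ltnW lt_t).
have [y Uy] : exists y, y \in U.
  by apply/set0Pn; rewrite -card_gt0; lia.
have step_push z : z \in U ->
    #|S| + #|V| = t.+1 + #|U :\ z| /\
    (U :\ z =i [predC [predU S & z :: q]] /\ [disjoint S & z :: q]).
  move=> Uz; have := cardsD1 z U; rewrite Uz => cU; split; first by lia.
  have := Uz; rewrite defU !inE negb_or => /andP[Sz qz].
  split; last by rewrite disjoint_sym disjoint_cons Sz disjoint_sym.
  by move=> v; rewrite !inE defU !inE !negb_or andbCA.
case: q defU disSq rq sub_qD step_push => [|x p] defU disSq rq sub_qD step_push.
  have [eqt' [defU' dis']] := step_push y Uy.
  exists S, (U :\ y), [:: y], D; split=> //.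
    by split=> //; have := subset_leq_card (subD1set U y); lia.
  by move=> u v Su /setD1P[_ Uv]; apply: noSU.
have [z /and3P[Uz hxz colz]|noz] :=
  pickP (fun z => [&& z \in U, h x z & col x z \notin D]).
  have [eqt' [defU' dis']] := step_push z Uz.
  exists S, (U :\ z), [:: z, x & p], (col x z |: D); split.
  - split=> //; last first.
      by have := cardsD1 z U; have := cardsU1 (col x z) D; rewrite Uz colz; lia.
    have := Uz; rewrite defU !inE negb_or => /andP[Sz qz].
    move: rq; rewrite /= hC hxz => /and3P[-> -> ->]; rewrite qz /= andbT colC.
    by apply: contra colz => /sub_qD.
  - move=> a; rewrite inE => /predU1P[->|]; first by rewrite colC setU11.
    by move=> /sub_qD Da; rewrite inE Da orbT.
  - by move=> u v Su /setD1P[_ Uv] huv; rewrite inE noSU ?orbT.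
(* The head [x] has no extension, so it retires to [S]: its edges to [U] all have colours in [D],
   which stays unchanged. *)
have Sx : x \notin S.
  by rewrite (disjointFl disSq) // mem_head.
have px : x \notin p by case/and3P: rq => _ /andP[].
exists (x |: S), U, p, D; split.
- split=> //.
  + by move=> v; rewrite defU !inE orbCA orbA.
  + apply/pred0P=> v /=; rewrite inE andb_orl; apply/norP; split.
      by rewrite inE; apply: contra px => /andP[/eqP->].
    by apply/negP=> /andP[Sv pv]; rewrite (disjointFl disSq) ?inE ?pv ?orbT in Sv.
  + by move: rq; case: (p) => //= w p' /and3P[/andP[_ ->] /andP[_ ->] /andP[_ ->]].
  + by rewrite cardsU1 Sx; lia.
- move: sub_qD; case: (p) => //= w p' sub a pa; apply: sub.
  by rewrite inE pa orbT.
- move=> u v /setU1P[->|Su] Uv huv; last exact: noSU.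
  by have := noz v; rewrite Uv huv /= => /negbFE.
Qed.

(** The bound [#|V|] leaves room for the colours of any path or cycle, and for the set [D] of the
    search. *)
Definition joined (k : nat) : Prop :=
  forall (A B : {set V}) (D : {set K}), [disjoint A & B] ->
    k <= #|A| -> k <= #|B| -> #|D| <= #|V| ->
    exists x y, [/\ x \in A, y \in B, h x y & col x y \notin D].

(** Stop the search at [t = #|V|], when [S] and [U] have equal size. Edges between them only have
    colours in [D], so both are smaller than [k], and the path holds all other vertices. *)
Lemma rainbow_long_path (k : nat) : 0 < k -> joined k ->
  exists q : seq V, rainbow_path q /\ #|V| + 2 <= size q + 2 * k.
Proof.
move=> k_gt0 jk.
have [S [U [q [D [[defU disSq rq eqt leD] _ noSU]]]]] := rainbow_dfs (leqnn _).
exists q; split=> //.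
have eqSU : #|S| = #|U| by lia.
have ltSk : #|S| < k.
  rewrite ltnNge; apply/negP=> leS.
  have disSU : [disjoint S & U].
    by apply/pred0P=> v /=; rewrite defU !inE negb_or; case: (v \in S).
  have [||x [y [Sx Uy hxy]]] := jk S U D disSU leS; rewrite -?eqSU //; first by lia.
  by rewrite (noSU x y).
have uq : uniq q by move: rq; case: (q) => //= ? ? /and3P[].
have : #|V| <= #|S| + #|U| + size q.
  rewrite -(card_uniqP uq) -cardsT.
  have -> : #|q| = #|[set v in q]| by rewrite cardsE.
  have sub : [set: V] \subset (S :|: U) :|: [set v in q].
    by apply/subsetP=> v _; rewrite !inE defU !inE negb_or; case: (v \in S); case: (v \in q).
  apply: leq_trans (subset_leq_card sub) _.
  apply: leq_trans (leq_card_setU _ _).1 _; rewrite leq_add2r.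
  exact: (leq_card_setU _ _).1.
lia.
Qed.

(** Starting [pairmap] at the last vertex lists the closing edge first. *)
Definition cycle_colours (s : seq V) : seq K :=
  if s is x :: p then pairmap col (last x p) s else [::].

Definition rainbow_cycle (e : rel V) (s : seq V) : bool :=
  [&& cycle e s, uniq s & uniq (cycle_colours s)].

Lemma rainbow_long_cycle (k : nat) : 0 < k -> 4 * k < #|V| -> joined k ->
  exists s : seq V, rainbow_cycle h s /\ #|V| < size s + 4 * k.
Proof.
move=> k_gt0 ltkV jk.
have [q [rq leq_q]] := rainbow_long_path k_gt0 jk.
have uq : uniq q by move: rq; case: (q) => //= ? ? /and3P[].
have sq : size q <= #|V| by rewrite -(card_uniqP uq) max_card.
pose D := [set a in path_colours q].
have leD : #|D| <= #|V|.
  rewrite cardsE; apply: leq_trans (card_size _) _; move: sq; case: (q) => //= x p.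
  by rewrite size_pairmap; lia.
pose A := [set v in take k q]; pose B := [set v in drop (size q - k) q].
have eqA : #|A| = k.
  by rewrite cardsE (card_uniqP _) ?take_uniq // size_takel //; lia.
have eqB : #|B| = k.
  by rewrite cardsE (card_uniqP _) ?drop_uniq // size_drop; lia.
have disAB : [disjoint A & B].
  apply/pred0P=> v /=; rewrite !inE; apply/negP=> /andP[Av Bv].
  have lt_i : index v q < k.
    by have := index_ltn Av.
  have : size q - k <= index v q.
    rewrite leqNgt; apply/negP=> lt_iq.
    have : v \in take (size q - k) q by rewrite in_take // (mem_drop Bv).
    move: uq; rewrite -{1}(cat_take_drop (size q - k) q) cat_uniq.
    by case/and3P=> _ /hasPn/(_ v Bv)/negP.
  by lia.
have [|||x [y [Ax By hxy colxy]]] := jk A B D disAB; rewrite ?eqA ?eqB //.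
move: Ax By; rewrite !inE => Ax By.
have lt_x : index x q < k by have := index_ltn Ax.
have lt_y : size q - k <= index y q.
  rewrite leqNgt; apply/negP=> lt_iq.
  have : y \in take (size q - k) q by rewrite in_take // (mem_drop By).
  move: uq; rewrite -{1}(cat_take_drop (size q - k) q) cat_uniq.
  by case/and3P=> _ /hasPn/(_ y By)/negP.
have qx : x \in q := mem_take Ax.
have qy : y \in q := mem_drop By.
have [q1 [q2 def_q]] : exists q1 q2 : seq V, q = q1 ++ x :: q2.
  by case/splitPr: qx => q1 q2; exists q1, q2.
move: uq lt_x lt_y qy; rewrite [q in uniq q]def_q [q in index x q]def_q [q in index y q]def_q.
rewrite [q in y \in q]def_q cat_uniq mem_cat inE /= !index_cat => /and3P[_ + _].
rewrite negb_or => /andP[/negbTE q1x _].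
have: size q1 + size q2 + 1 = size q by rewrite def_q size_cat /=; lia.
rewrite q1x /= eqxx addn0 eq_sym.
(* The path has more than [2 * k] vertices, with [x] among the first [k] and [y] among the last [k],
   so [y] can only come after [x]. *)
case: (boolP (y \in q1)) => [q1y size_q lt_x lt_y|q1y size_q lt_x].
  have lt_iq1 : index y q1 < size q1 by rewrite index_mem.
  have {}lt_x : size q1 < k by [].
  by exfalso; lia.
case: eqVneq => [_ lt_y|neq_xy lt_y /= q2y]; first by exfalso; lia.
have [t [q3 def_q2]] : exists t q3 : seq V, q2 = t ++ y :: q3.
  by case/splitPr: q2y => t q3; exists t, q3.
have [rt sub] : rainbow_path (x :: rcons t y) /\
    {subset pairmap col x (rcons t y) <= path_colours q}.
  by have := @rainbow_path_infix q1 q3 (rcons t y) x; rewrite cat_rcons -def_q2 -def_q; apply.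
exists (x :: rcons t y); split.
  case/and3P: rt => ht ut ct; rewrite /rainbow_cycle ut /= rcons_path ht last_rcons hC hxy /=.
  by rewrite colC ct andbT; apply: contra colxy => /sub; rewrite inE.
have le_t : index y q2 <= size t.
  by rewrite def_q2 index_cat /= eqxx addn0; case: ifP => //; rewrite -index_mem => /ltnW.
have {}lt_x : size q1 < k by [].
have {}lt_y : size q - k <= size q1 + (index y q2).+1 by [].
have le_q : size q <= k + k + size t + 1 by lia.
have lt_t : #|V| < (size t).+2 + 4 * k by lia.
by rewrite /= size_rcons.
Qed.

End RainbowCycles.

(** * Inserting missing vertices into a rainbow cycle *)

Section Insertion.
Import mathcomp.boot.fintype mathcomp.boot.finset.
Local Open Scope nat_scope.

Variables (V K : finType) (h g : rel V) (col : V -> V -> K).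
Hypothesis colC : forall x y, col x y = col y x.

Lemma cycle_colours_last (x0 : V) (s : seq V) :
  cycle_colours col s = pairmap col (last x0 s) s.
Proof. by case: s. Qed.

Lemma last_rev_belast (x : V) (p : seq V) : last (last x p) (rev (belast x p)) = x.
Proof. by case: p => //= y p; rewrite rev_cons last_rcons. Qed.

(** Write [y] for [last x' t]. The stretch x x' ... y y' becomes x u y ... x' y': the segment from
    [x'] to [y] is traversed backwards, which by symmetry keeps its edges and colours. *)
Lemma rainbow_cycle_insert (e : rel V) (s1 s3 t : seq V) (x x' y' u : V) :
  symmetric e -> rainbow_cycle col e (s1 ++ x :: x' :: t ++ y' :: s3) ->
  u \notin s1 ++ x :: x' :: t ++ y' :: s3 ->
  [&& e x u, e u (last x' t) & e x' y'] ->
  uniq [:: col x u; col u (last x' t); col x' y'] ->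
  ~~ has [in cycle_colours col (s1 ++ x :: x' :: t ++ y' :: s3)]
     [:: col x u; col u (last x' t); col x' y'] ->
  rainbow_cycle col e (s1 ++ x :: u :: rev (x' :: t) ++ y' :: s3) /\
  {subset cycle_colours col (s1 ++ x :: u :: rev (x' :: t) ++ y' :: s3) <=
    [:: col x u; col u (last x' t); col x' y'] ++
      cycle_colours col (s1 ++ x :: x' :: t ++ y' :: s3)}.
Proof.
move=> eC /and3P[cs us ccs] su /and3P[exu euy exy'] u3 n3.
set s := s1 ++ _ in cs us ccs su n3 *; set s' := s1 ++ _.
have lasts : last u s = last y' s3 by rewrite /s last_cat /= last_cat.
have lasts' : last u s' = last y' s3 by rewrite /s' last_cat /= last_cat.
have revt : rev (x' :: t) = last x' t :: rev (belast x' t) by rewrite lastI rev_rcons.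
(* As multisets, the new colours and the two removed ones together are the old colours and the three
   added ones; both uniqueness and the inclusion follow. *)
have permc : perm_eq (cycle_colours col s' ++ [:: col x x'; col (last x' t) y'])
    ([:: col x u; col u (last x' t); col x' y'] ++ cycle_colours col s).
  rewrite !(cycle_colours_last u) lasts lasts' /s /s' revt.
  rewrite !pairmap_cat /= !pairmap_cat /= last_rev_belast pairmap_rev //.
  apply/permP=> a; rewrite !(count_cat, count_rev) /= !count_cat /= count_rev.
  by rewrite count_cat /=; ring.
have sub : {subset cycle_colours col s' <=
    [:: col x u; col u (last x' t); col x' y'] ++ cycle_colours col s}.
  by move=> a sa; rewrite -(perm_mem permc) mem_cat sa.
split=> //; apply/and3P; split.
- move: cs; rewrite !(cycle_path u) lasts lasts' /s /s' revt.
  rewrite !cat_path /= !cat_path /= last_rev_belast rev_path exu euy exy' /=.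
  rewrite (eq_path (e' := e)); last by move=> a b; rewrite eC.
  by case/and4P=> -> -> _ /and3P[-> _ ->].
- have : perm_eq s' (u :: s).
    apply/permP=> a; rewrite /s /s' /= !count_cat /= !count_cat /= count_rev /=; ring.
  by move/perm_uniq=> ->; rewrite /= su.
- have : uniq (cycle_colours col s' ++ [:: col x x'; col (last x' t) y']).
    rewrite (perm_uniq permc) cat_uniq u3 ccs andbT /=.
    by rewrite has_sym.
  by rewrite cat_uniq => /andP[].
Qed.

Hypothesis hC : symmetric h.
Hypothesis gC : symmetric g.
Variables (D0 : {set K}) (k : nat).
Hypothesis hD0 : forall x y, h x y -> col x y \notin D0.
Hypothesis gD0 : forall x y, g x y -> col x y \in D0.
Hypothesis k_gt0 : 0 < k.
Hypothesis jk : joined h col k.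
Hypothesis gk : forall u,
  11 * k <= #|[set a | [exists v, g u v && (col u v == a)]]|.

Let e : rel V := fun x y => h x y || g x y.

(* An insertion spends two colours of D0 and covers one vertex, so the
   colours of D0 on the cycle plus twice the missing vertices never exceed the
   initial 8 k; at least 2 k of the 11 k colours seen at u remain usable. *)
Lemma rainbow_cycle_extend (s : seq V) (u : V) :
  rainbow_cycle col e s -> u \notin s ->
  #|[set a in D0 | a \in cycle_colours col s]| + 2 * (#|V| - size s) <= 8 * k ->
  exists s' : seq V, [/\ rainbow_cycle col e s', size s' = (size s).+1 &
    #|[set a in D0 | a \in cycle_colours col s']| + 2 * (#|V| - size s') <= 8 * k].
Proof.
move=> cs su le_s; have [_ us _] := and3P cs.
have eC : symmetric e by move=> x y; rewrite /e hC gC.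
have lt_sV : size s < #|V|.
  rewrite -(card_uniqP us) -cardsT -[in X in X < _]cardsE.
  by apply: proper_card; apply/properP; split; [exact: subsetT | exists u; rewrite !inE].
(* The successor along [s] without wrapping around; it is only used below the last position, where
   the default [u] does not occur. *)
pose nx v := nth u s (index v s).+1.
have main x y : index x s < index y s -> (index y s).+1 < size s ->
    g u x -> g u y -> col u x != col u y ->
    col u x \notin cycle_colours col s -> col u y \notin cycle_colours col s ->
    h (nx x) (nx y) -> col (nx x) (nx y) \notin cycle_colours col s ->
    exists s' : seq V, [/\ rainbow_cycle col e s', size s' = (size s).+1 &
    #|[set a in D0 | a \in cycle_colours col s']| + 2 * (#|V| - size s') <= 8 * k].
  move=> lt_xy lt_y gux guy neqc cx cy hxy cxy.
  have sx : x \in s by rewrite -index_mem; exact: ltn_trans lt_xy (ltnW lt_y).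
  have [s1 [s2 def_s]] : exists s1 s2 : seq V, s = s1 ++ x :: s2.
    by case/splitPr: sx => s1 s2; exists s1, s2.
  have s1x : x \notin s1.
    by move: us; rewrite def_s cat_uniq /= negb_or => /and3P[_ /andP[]].
  have ix : index x s = size s1.
    by rewrite def_s index_cat (negbTE s1x) /= eqxx addn0.
  have s1y : y \notin s1.
    by apply/negP=> s1y; move: lt_xy; rewrite ix ltnNge def_s index_cat s1y index_size.
  have neq_xy : x != y by apply: contraTneq lt_xy => ->; rewrite ltnn.
  have sy : y \in s by rewrite -index_mem; exact: ltnW lt_y.
  have [t1 [w def_s2]] : exists t1 w : seq V, s2 = t1 ++ y :: w.
    have : y \in s2 by move: sy; rewrite def_s mem_cat (negbTE s1y) inE eq_sym (negbTE neq_xy).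
    by case/splitPr=> t1 w; exists t1, w.
  have t1y : y \notin t1.
    move: us; rewrite def_s def_s2 cat_uniq => /and3P[_ _ /= /andP[_]].
    by rewrite cat_uniq /= negb_or => /and3P[_ /andP[]].
  have iy : index y s = (size s1 + size t1).+1.
    rewrite def_s def_s2 index_cat (negbTE s1y) /= (negbTE neq_xy) index_cat (negbTE t1y) /= eqxx.
    by rewrite addn0 addnS.
  case: w def_s2 => [|y' s3] def_s2.
    by move: lt_y; rewrite iy def_s def_s2 size_cat /= size_cat /= addn1 !addnS ltnn.
  (* This also covers [y] directly after [x]: then [x' = y] and [t] is empty. *)
  have [x' [t [def_t last_t]]] : exists x' t, rcons t1 y = x' :: t /\ last x' t = y.
    case: (t1) => [|x' t]; first by exists y, [::].
    by exists x', (rcons t y); rewrite last_rcons.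
  have {}def_s : s = s1 ++ x :: x' :: t ++ y' :: s3.
    by rewrite def_s def_s2 -(cat_rcons y t1) def_t.
  have nxx : nx x = x'.
    by rewrite /nx ix def_s nth_cat ltnNge leqnSn /= subSnn.
  have nxy : nx y = y'.
    have size_t : size t1 = size t.
      by apply: succn_inj; rewrite -[RHS]/(size (x' :: t)) -def_t size_rcons.
    have eq_i : (size s1 + size t).+2 = size s1 + (size t).+2 by rewrite !addnS.
    rewrite /nx iy size_t eq_i def_s nth_cat ltnNge leq_addr addKn /=.
    by rewrite nth_cat ltnn subnn.
  rewrite nxx nxy in hxy cxy.
  have [] := @rainbow_cycle_insert e s1 s3 t x x' y' u eC; rewrite -?def_s ?last_t //.
  - by rewrite /e hxy (gC x u) gux guy !orbT.
  - rewrite /= !inE !negb_or colC neqc /= andbT.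
    by apply/andP; split; apply: contraNneq (hD0 hxy) => <-; exact: gD0.
  - by rewrite /= colC !negb_or cx cy cxy.
  set s' := s1 ++ _ => cs' sub'.
  have size_s' : size s' = (size s).+1.
    by rewrite /s' def_s !size_cat /= !size_cat size_rev /=; ring.
  exists s'; split=> //.
  (* Only the two edges at [u] bring in colours of [D0], since the third new edge satisfies [h]. *)
  have : #|[set a in D0 | a \in cycle_colours col s']| <=
      2 + #|[set a in D0 | a \in cycle_colours col s]|.
    have /subset_leq_card le1 : [set a in D0 | a \in cycle_colours col s'] \subset
       [set col u x; col u y] :|: [set a in D0 | a \in cycle_colours col s].
      apply/subsetP=> a; rewrite !inE => /andP[D0a /sub']; rewrite D0a /= !inE (colC x u).
      case/or4P=> [->|->|/eqP eqa|->]; rewrite ?orbT //.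
      by have := hD0 hxy; rewrite -eqa D0a.
    apply: leq_trans le1 _; apply: leq_trans (leq_card_setU _ _).1 _.
    by rewrite leq_add2r cards2; case: eqP.
  by move: le_s lt_sV; rewrite size_s'; clear; lia.
pose W := [set a | [exists v, g u v && (col u v == a)]].
(* One neighbour is kept per colour, so that distinct usable neighbours have distinct colours at
   [u]. *)
pose phi a := odflt u [pick v | g u v && (col u v == a)].
have phiP a : a \in W -> g u (phi a) /\ col u (phi a) = a.
  rewrite inE /phi => /existsP[v guv]; case: pickP => [w /andP[? /eqP] //|/(_ v)].
  by rewrite guv.
pose W1 := W :\: [set a in D0 | a \in cycle_colours col s].
pose N := [set v in phi @: W1 | (index v s).+1 < size s].
have NP v : v \in N -> [/\ g u v, col u v \notin cycle_colours col s,
    phi (col u v) = v & (index v s).+1 < size s].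
  rewrite inE => /andP[/imsetP[a /setDP[Wa na] ->] ->].
  have [gua eqa] := phiP a Wa; rewrite eqa; split=> //.
  by apply: contra na => ca; rewrite !inE ca -eqa gD0.
(* From [11 * k] colours remove those on the cycle, those leading to missing vertices and the one
   that may lead to the last vertex of [s]. The invariant bounds the first two losses by [8 * k]
   together, leaving [3 * k - 1 >= 2 * k]. *)
have cardN : 2 * k <= #|N|.
  have cardW1 : #|W| <= #|W1| + #|[set a in D0 | a \in cycle_colours col s]|.
    by rewrite addnC; apply: leq_trans (leq_card_setU _ _).1; apply: subset_leq_card;
      apply/subsetP=> a Wa; rewrite in_setU in_setD Wa andbT orbN.
  have eqW1 : #|phi @: W1| = #|W1|.
    apply: card_in_imset => a b /setDP[/phiP[_ ea] _] /setDP[/phiP[_ eb] _] eqab.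
    by rewrite -ea eqab eb.
  have sizeU : #|[set v | v \notin s]| = #|V| - size s.
    have -> : [set v | v \notin s] = ~: [set v in s] by apply/setP=> v; rewrite !inE.
    by rewrite cardsCs setCK cardsE (card_uniqP us).
  have : #|phi @: W1| <= #|N| + #|[set v | v \notin s]| + 1.
    have /subset_leq_card le1 : phi @: W1 \subset (N :|: [set v | v \notin s]) :|: [set last u s].
      apply/subsetP=> v Wv; rewrite !inE Wv /=; case: (boolP (v \in s)) => [sv /=|_]; last by rewrite orbT.
      rewrite orbF; case: ltnP => //= le_v.
      have lt_v : index v s < size s by rewrite index_mem.
      by rewrite -nth_last -[in X in X == _](nth_index u sv); apply/eqP; congr nth; move: lt_v le_v; clear; lia.
    apply: leq_trans le1 _; apply: leq_trans (leq_card_setU _ _).1 _; rewrite cards1 leq_add2r.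
    exact: (leq_card_setU _ _).1.
  by move: (gk u) k_gt0 le_s cardW1; rewrite -/W eqW1 sizeU; clear; lia.
have nx_inj : {in N &, injective nx}.
  move=> v w /NP[_ _ _ lt_v] /NP[_ _ _ lt_w] /eqP; rewrite nth_uniq // eqSS => /eqP eqi.
  have sv : v \in s by rewrite -index_mem; exact: ltnW lt_v.
  have sw : w \in s by rewrite -index_mem; exact: ltnW lt_w.
  by rewrite -(nth_index u sv) eqi nth_index.
pose A0 := nx @: N.
have cardA0 : 2 * k <= #|A0| by rewrite card_in_imset.
(* The at least [2 * k] successors are split into two disjoint sets of size at least [k], to which
   [joined] applies. *)
pose A := [set v in take k (enum A0)].
have subA : A \subset A0.
  by apply/subsetP=> v; rewrite inE => /mem_take; rewrite mem_enum.
have cardA : #|A| = k.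
  rewrite cardsE (card_uniqP _) ?take_uniq ?enum_uniq // size_takel // -cardE.
  by move: cardA0; clear; lia.
have cardB : k <= #|A0 :\: A| by rewrite cardsD (setIidPr subA) cardA; move: cardA0; clear; lia.
have [||||a [b [Aa /setDP[Bb nAb] hab cab]]] :=
  jk (A := A) (B := A0 :\: A) (D := [set a in cycle_colours col s]).
- by apply/pred0P=> v /=; rewrite !inE; case: (v \in take _ _).
- by rewrite cardA.
- by [].
- rewrite cardsE; apply: leq_trans (card_size _) _; apply: leq_trans (ltnW lt_sV).
  by rewrite (cycle_colours_last u) size_pairmap.
move: cab; rewrite inE => cab.
have /imsetP[x Nx def_a] := subsetP subA _ Aa.
have /imsetP[y Ny def_b] := Bb.
have [gux cx phix lt_x] := NP x Nx; have [guy cy phiy lt_y] := NP y Ny.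
have neq_xy : x != y.
  by apply: contraNneq nAb => eq_xy; rewrite def_b -eq_xy -def_a.
have neqc : col u x != col u y.
  by apply: contraNneq neq_xy => eqc; rewrite -phix -phiy eqc.
subst a b; case: (ltngtP (index x s) (index y s)) => lt_xy.
- exact: (main x y).
- by apply: (main y x) => //; [rewrite eq_sym | rewrite hC | rewrite colC].
have sx : x \in s by rewrite -index_mem; exact: ltnW lt_x.
have sy : y \in s by rewrite -index_mem; exact: ltnW lt_y.
by move: neq_xy; rewrite -(nth_index u sx) lt_xy nth_index ?eqxx.
Qed.

Lemma path_colours_notin (x : V) (p : seq V) (a : K) :
  path h x p -> a \in pairmap col x p -> a \notin D0.
Proof.
elim: p x => //= y p IHp x /andP[hxy hp]; rewrite inE => /predU1P[->|]; first exact: hD0.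
exact: IHp.
Qed.

Lemma rainbow_hamilton_cycle : 4 * k < #|V| ->
  exists s : seq V, rainbow_cycle col e s /\ size s = #|V|.
Proof.
move=> lt_kV.
have [s0 [cs0 le_s0]] := rainbow_long_cycle colC hC k_gt0 lt_kV jk.
have leVs s : rainbow_cycle col e s -> size s <= #|V|.
  by case/and3P=> _ us _; rewrite -(card_uniqP us) max_card.
have {le_s0 cs0} [s [cs le_s]] : exists s : seq V, rainbow_cycle col e s /\
    #|[set a in D0 | a \in cycle_colours col s]| + 2 * (#|V| - size s) <= 8 * k.
  (* The initial cycle only has edges of [h], hence no colour of [D0], and misses fewer than [4 * k]
     vertices: the invariant holds at the start. *)
  exists s0; case/and3P: cs0 => c0 u0 cc0; split.
    rewrite /rainbow_cycle u0 cc0 !andbT.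
    by case: (s0) c0 => //= x p; apply: sub_path => a b; rewrite /e => ->.
  suff -> : [set a in D0 | a \in cycle_colours col s0] = set0 by rewrite cards0; lia.
  apply/setP=> a; rewrite !inE; apply/negP=> /andP[D0a].
  case: (s0) c0 => // x p; rewrite (cycle_path x) (cycle_colours_last x) => c0.
  by move/(path_colours_notin c0); rewrite D0a.
have [m] := ubnP (#|V| - size s); elim: m s cs le_s => // m IHm s cs le_s lt_m.
have [eq_s|neq_s] := eqVneq (size s) #|V|; first by exists s.
have [_ us _] := and3P cs.
have [u su] : exists u, u \notin s.
  apply/existsP; apply: contraNT neq_s => /existsPn sV; rewrite -(card_uniqP us).
  by apply/eqP/eq_card => v; rewrite !inE; move: (sV v); rewrite negbK.
have [s' [cs' size_s' le_s']] := rainbow_cycle_extend cs su le_s.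
apply: (IHm s') => //; have := leVs _ cs'; lia.
Qed.

End Insertion.

(** * The two obstructions *)

Section Bridge.
Import mathcomp.boot.fintype mathcomp.boot.finset.
Local Open Scope nat_scope.

Lemma cycle_colours_prev (V K : finType) (col : V -> V -> K) (s : seq V) :
  uniq s -> cycle_colours col s = [seq col (prev s x) x | x <- s].
Proof.
case: s => // x p up; apply: (@eq_from_nth _ (col x x)).
  by rewrite size_pairmap size_map.
rewrite size_pairmap => i lt_i; rewrite (nth_pairmap x) // (nth_map x) //.
rewrite prev_nth mem_nth //; congr (col _ _).
have /= /andP[px up'] := up.
case: i lt_i => [|i] lt_i /=; last by rewrite index_uniq.
by rewrite (memNindex px); exact: esym (nth_last x (x :: p)).
Qed.

(** [cycle_colours] attaches an edge to its second endpoint, whereas [on_cycle] uses the first;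
    [prev_next] translates. *)
Lemma cycle_colours_inj (V K : finType) (col : V -> V -> K) (s : seq V) :
  uniq s -> uniq (cycle_colours col s) ->
  {in s &, injective (fun x => col x (next s x))}.
Proof.
move=> us; rewrite cycle_colours_prev // => uc x y sx sy eqc.
have nP z : col z (next s z) = col (prev s (next s z)) (next s z) by rewrite prev_next.
rewrite nP (nP y) in eqc.
have {eqc} : next s x = next s y.
  set x' := next s x in eqc *; set y' := next s y in eqc *.
  have sx' : x' \in s by rewrite mem_next.
  have sy' : y' \in s by rewrite mem_next.
  have := @nth_uniq _ (col x x) _ (index x' s) (index y' s) _ _ uc.
  rewrite size_map !index_mem sx' sy' !(nth_map x) ?index_mem // !nth_index // eqc eqxx.
  by move=> /(_ isT isT)/esym/eqP/(congr1 (nth x s)); rewrite !nth_index.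
by move/(congr1 (prev s)); rewrite !prev_next.
Qed.

Definition between (V : finType) (A B : {set V}) : {set vpair V} :=
  [set e : vpair V | [exists x in A, exists y in B, val e == [set x; y]]].

Definition star (V : finType) (u : V) : {set vpair V} :=
  [set e : vpair V | u \in val e].

(** Both obstructions are events of this form, whose probability given [E] is a plain power. *)
Definition coloured_in (V : finType) (r : nat) (F : {set vpair V})
    (X : {set 'I_r}) (E : sgraph V) (c : colouring E r) : bool :=
  [forall e : {e : vpair V | e \in E}, (val e \in F) ==> (c e \in X)].

Lemma no_rainbow_obstruction (V : finType) (r k : nat) (D0 : {set 'I_r})
    (E : sgraph V) (c : colouring E r) :
  0 < r -> 0 < k -> 4 * k < #|V| -> ~~ has_rainbow_hamilton_cycle c ->
  (exists (A B : {set V}) (D : {set 'I_r}), [/\ [disjoint A & B], k <= #|A|, k <= #|B|, #|D| <= #|V| &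
     coloured_in (between A B) (D :|: D0) c]) \/
  (exists (u : V) (B : {set 'I_r}), [/\ B \subset D0, #|B| <= 11 * k &
     coloured_in (star u) (B :|: ~: D0) c]).
Proof.
move=> r_gt0 k_gt0 lt_kV norainbow; apply: contrapT => /not_orP[noJ noS].
case/negP: norainbow.
pose ed := {e : vpair V | e \in E}.
(* Non-edges get a dummy colour; [h] and [g] below split the actual edges according to whether their
   colour avoids [D0]. *)
pose col x y := odflt (Ordinal r_gt0) (omap c [pick e : ed | val (val e) == [set x; y]]).
have colE (e : ed) x y : val (val e) = [set x; y] -> col x y = c e.
  move=> def_e; rewrite /col; case: pickP => [e' /eqP def_e'|/(_ e)]; last by rewrite def_e eqxx.
  by congr (c _); do 2 apply: val_inj; rewrite def_e'.
have colC x y : col x y = col y x by rewrite /col setUC.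
pose h x y := [exists e : ed, (val (val e) == [set x; y]) && (c e \notin D0)].
pose g x y := [exists e : ed, (val (val e) == [set x; y]) && (c e \in D0)].
have hC : symmetric h by move=> x y; rewrite /h setUC.
have gC : symmetric g by move=> x y; rewrite /g setUC.
have hD0 x y : h x y -> col x y \notin D0.
  by case/existsP=> e /andP[/eqP/colE ->].
have gD0 x y : g x y -> col x y \in D0.
  by case/existsP=> e /andP[/eqP/colE ->].
have jk : joined h col k.
  move=> A B D disAB leA leB leD; apply: contrapT => no_xy.
  apply: noJ; exists A, B, D; split=> //; apply/forallP=> e; apply/implyP.
  rewrite inE => /exists_inP[x Ax /exists_inP[y By /eqP def_e]].
  rewrite inE; apply: contrapT => /negP; rewrite negb_or => /andP[nD nD0].
  apply: no_xy; exists x, y; rewrite (colE e) //; split=> //.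
  by apply/existsP; exists e; rewrite def_e eqxx.
have gk u : 11 * k <= #|[set a | [exists v, g u v && (col u v == a)]]|.
  (* If [u] saw too few reserved colours, the set [B] of those it sees would be an obstruction of
     the second kind. *)
  set B := [set a | _]; rewrite leqNgt; apply/negP=> ltB.
  apply: noS; exists u, B; split; last first.
  - apply/forallP=> e; apply/implyP; rewrite !inE => ue.
    have [v def_e] : exists v, val (val e) = [set u; v].
      have /cards2P[x [y [_ def_e]]] := valP (val e).
      move: ue; rewrite def_e !inE => /orP[]/eqP->; first by exists y.
      by exists x; rewrite setUC.
    case: (boolP (c e \in D0)) => [D0e|]; last by rewrite orbT.
    rewrite orbF; apply/existsP; exists v; rewrite (colE e) // eqxx andbT.
    by apply/existsP; exists e; rewrite def_e eqxx.
  - exact: ltnW.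
  - by apply/subsetP=> a; rewrite inE => /existsP[v /andP[/gD0 + /eqP <-]].
have [s [/and3P[cs us cc] size_s]] :=
  rainbow_hamilton_cycle colC hC gC hD0 gD0 k_gt0 jk gk lt_kV.
have size_sV : size s == #|V| by rewrite size_s.
apply/existsP; exists (Tuple size_sV); apply/andP; split.
  rewrite /hamilton_cycle /= size_sV /ucycleb us andbT /=; apply/andP; split.
    by apply: leq_trans lt_kV; move: k_gt0; clear; lia.
  case: (s) cs => //= x p; apply: sub_path => a b /orP[] /existsP[e /andP[def_e _]];
  by apply/exists_inP; exists (val e); rewrite ?(valP e).
apply/dinjectiveP=> e e'; rewrite !inE.
case/exists_inP=> x sx /eqP def_e /exists_inP[y sy /eqP def_e'] eqc.
do 2 apply: val_inj; rewrite def_e def_e'.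
have -> // : x = y.
by apply: (cycle_colours_inj us cc) => //; rewrite (colE e) // (colE e').
Qed.
End Bridge.

(** * Union bound *)

Section Probability.
Import mathcomp.boot.fintype mathcomp.boot.finset.
Local Open Scope ring_scope.
Variables (R : realType) (V : finType) (p : R) (G : sgraph V) (r : nat).
Hypothesis p01 : 0 <= p <= 1.
Hypothesis r_gt0 : (0 < r)%N.

Notation pr := (@perturbed_prob R V p G r).

Lemma gnp_weight_ge0 (H : sgraph V) : 0 <= gnp_weight p H.
Proof.
have /andP[p0 p1] := p01.
by apply: prodr_ge0 => e _; case: ifP => _; rewrite ?subr_ge0.
Qed.

Lemma colouring_weight_ge0 (E : sgraph V) (c : colouring E r) :
  0 <= colouring_weight R c.
Proof. by apply: prodr_ge0 => e _; rewrite invr_ge0 ler0n. Qed.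

(** Independence factors the expectation over pairs: a pair of [F] contributes [p * q + (1 - p)],
    any other pair 1. *)
Lemma sum_gnp_weight_exp (F : {set vpair V}) (q : R) :
  \sum_(H : sgraph V) gnp_weight p H * q ^+ #|H :&: F| = (1 - p * (1 - q)) ^+ #|F|.
Proof.
transitivity (\prod_(e : vpair V) (p * (if e \in F then q else 1) + (1 - p))).
  rewrite bigA_distr; apply: eq_bigr => H _.
  have -> : q ^+ #|H :&: F| = \prod_(e : vpair V) (if e \in H then if e \in F then q else 1 else 1).
    rewrite -prodr_const big_mkcond; apply: eq_bigr => e _; rewrite inE.
    by case: (e \in H); case: (e \in F).
  rewrite -big_split; apply: eq_bigr => e _ /=; case: ifP => //; by rewrite mulr1.
rewrite -prodr_const [RHS]big_mkcond; apply: eq_bigr => e _.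
by case: ifP => _; ring.
Qed.

Lemma sum_gnp_weight : \sum_(H : sgraph V) gnp_weight p H = 1.
Proof.
have := sum_gnp_weight_exp finset.set0 1; rewrite cards0 expr0 => <-.
by apply: eq_bigr => H _; rewrite setI0 cards0 expr0 mulr1.
Qed.

(** Independence again: each edge in [F] contributes [#|X| / r], and each other edge 1. *)
Lemma sum_colouring_weight_in (E : sgraph V) (F : {set vpair V}) (X : {set 'I_r}) :
  \sum_(c : colouring E r | coloured_in F X c) colouring_weight R c =
  (#|X|%:R / r%:R) ^+ #|E :&: F|.
Proof.
transitivity (\prod_(e : {e : vpair V | e \in E})
   \sum_(j : 'I_r) if (val e \in F) ==> (j \in X) then r%:R^-1 else 0 : R).
  rewrite bigA_distr_bigA big_mkcond; apply: eq_bigr => c _; rewrite /coloured_in.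
  case: forallP => [cX|]; first by apply: eq_bigr => e _; rewrite cX.
  case/existsNP=> e /negP/negbTE ceX.
  by rewrite (bigD1 e) //= ceX mul0r.
have rneq0 : r%:R != 0 :> R by rewrite pnatr_eq0 -lt0n.
transitivity (\prod_(e : {e : vpair V | e \in E} | val e \in F) (#|X|%:R / r%:R : R)).
  rewrite [RHS]big_mkcond; apply: eq_bigr => e _; rewrite -big_mkcond /=.
  case: ifP => _ /=; rewrite sumr_const -(mulr_natl (r%:R^-1)) //.
  by rewrite (eq_card (B := predT)) ?card_ord ?divff.
rewrite prodr_const; congr (_ ^+ _).
rewrite -(card_imset _ (val_inj : injective (val : {e : vpair V | e \in E} -> _))).
apply: eq_card => e; rewrite inE; apply/imsetP/andP => [[e' Fe' ->]|[Ee Fe]].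
  by rewrite (valP e').
by exists (Sub e Ee); rewrite // SubK.
Qed.

(** As [q <= 1], the exponent may be lowered to the edges of [H] in [F]; then average over [H]. The
    next lemma keeps the edges of [G] instead. *)
Lemma perturbed_prob_coloured_in_random (F : {set vpair V}) (X : {set 'I_r}) (q : R) :
  #|X|%:R / r%:R <= q <= 1 ->
  pr (@coloured_in V r F X) <= (1 - p * (1 - q)) ^+ #|F|.
Proof.
case/andP=> leXq q1; rewrite -sum_gnp_weight_exp; apply: ler_sum => H _.
apply: ler_wpM2l; first exact: gnp_weight_ge0.
have X0 : 0 <= #|X|%:R / r%:R :> R by rewrite divr_ge0 ?ler0n.
rewrite sum_colouring_weight_in; apply: (@le_trans _ _ (q ^+ #|(G :|: H) :&: F|)).
  by apply: lerXn2r; rewrite ?nnegrE // (le_trans X0).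
apply: ler_wiXn2l => //; first exact: le_trans leXq.
by apply: subset_leq_card; rewrite setSI // subsetUr.
Qed.

Lemma perturbed_prob_coloured_in_fixed (F : {set vpair V}) (X : {set 'I_r}) (q : R) :
  #|X|%:R / r%:R <= q <= 1 ->
  pr (@coloured_in V r F X) <= q ^+ #|G :&: F|.
Proof.
case/andP=> leXq q1; rewrite -[leRHS]mul1r -sum_gnp_weight mulr_suml; apply: ler_sum => H _.
apply: ler_wpM2l; first exact: gnp_weight_ge0.
have X0 : 0 <= #|X|%:R / r%:R :> R by rewrite divr_ge0 ?ler0n.
rewrite sum_colouring_weight_in; apply: (@le_trans _ _ (q ^+ #|(G :|: H) :&: F|)).
  by apply: lerXn2r; rewrite ?nnegrE // (le_trans X0).
apply: ler_wiXn2l => //; first exact: le_trans leXq.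
by apply: subset_leq_card; rewrite setSI // subsetUl.
Qed.

Lemma perturbed_prob_not (A : forall E : sgraph V, colouring E r -> bool) :
  pr A = 1 - pr (fun E c => ~~ A E c).
Proof.
apply/eqP; rewrite eq_sym subr_eq; apply/eqP; rewrite -big_split /= -sum_gnp_weight.
apply: eq_bigr => H _; rewrite -mulrDr -[LHS]mulr1; congr (_ * _).
transitivity (\sum_(c : colouring (G :|: H) r) colouring_weight R c).
  (* With [F] empty the event is certain, which gives total mass 1. *)
  have := sum_colouring_weight_in (G :|: H) finset.set0 finset.setT.
  rewrite setI0 cards0 expr0 => <-; apply: eq_bigl => c.
  by apply/forallP => e; rewrite !inE.
by rewrite (bigID (fun c => A _ c)).
Qed.

Lemma perturbed_prob_ge0 (A : forall E : sgraph V, colouring E r -> bool) : 0 <= pr A.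
Proof.
apply: sumr_ge0 => H _; rewrite mulr_ge0 ?gnp_weight_ge0 //.
by apply: sumr_ge0 => c _; apply: colouring_weight_ge0.
Qed.

Lemma le_sum_cover (T I : finType) (P : pred I) (a : pred T) (b : I -> pred T) (w : T -> R) :
  (forall t, 0 <= w t) -> (forall t, a t -> exists2 i, P i & b i t) ->
  \sum_(t | a t) w t <= \sum_(i | P i) \sum_(t | b i t) w t.
Proof.
move=> w0 cover; under [leRHS]eq_bigr do rewrite big_mkcond.
rewrite exchange_big big_mkcond; apply: ler_sum => t _.
have term0 i : 0 <= (if b i t then w t else 0) by case: ifP.
case: ifP => [/cover[i Pi bit]|_]; last exact: sumr_ge0.
by rewrite (bigD1 i) //= bit lerDl; apply: sumr_ge0.
Qed.

Lemma perturbed_prob_cover (I : finType) (P : pred I)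
    (A : forall E : sgraph V, colouring E r -> bool)
    (B : I -> forall E : sgraph V, colouring E r -> bool) :
  (forall E c, A E c -> exists2 i, P i & B i E c) -> pr A <= \sum_(i | P i) pr (B i).
Proof.
move=> cover; rewrite exchange_big /=; apply: ler_sum => H _; rewrite -mulr_sumr.
apply: ler_wpM2l; first exact: gnp_weight_ge0.
apply: le_sum_cover => [c|c /cover //]; exact: colouring_weight_ge0.
Qed.

Lemma perturbed_prob_or (A B C : forall E : sgraph V, colouring E r -> bool) :
  (forall E c, A E c -> B E c || C E c) -> pr A <= pr B + pr C.
Proof.
move=> cover; have := @perturbed_prob_cover bool predT A (fun b => if b then B else C).
rewrite big_bool /=; apply=> E c /cover/orP[]; by [exists true | exists false].
Qed.

(** Disjointness makes the map from ordered pairs in the product of [A] and [B] to unordered pairs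
    injective. *)
Lemma leq_card_between (A B : {set V}) :
  [disjoint A & B] -> (#|A| * #|B| <= #|between A B|)%N.
Proof.
move=> disAB; rewrite -cardsX -(card_imset (mem (between A B)) val_inj).
rewrite -(@card_in_imset _ _ (fun z : V * V => [set z.1; z.2])).
  apply: subset_leq_card; apply/subsetP=> _ /imsetP[[x y] /setXP[/= Ax By] ->].
  have nxy : x != y by apply: contraTneq By => <-; rewrite (disjointFr disAB Ax).
  have e2 : #|[set x; y]| == 2 by rewrite cards2 nxy.
  apply/imsetP; exists (Sub [set x; y] e2); last by rewrite SubK.
  by rewrite inE SubK; apply/exists_inP; exists x => //; apply/exists_inP; exists y.
move=> [x y] [x' y'] /setXP[/= Ax By] /setXP[/= Ax' By'] eqs; congr (_, _).
  have : x \in [set x'; y'] by rewrite -eqs set21.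
  rewrite !inE => /orP[/eqP //|/eqP eqx].
  by rewrite eqx (disjointFl disAB By') in Ax.
have : y \in [set x'; y'] by rewrite -eqs set22.
rewrite !inE => /orP[/eqP eqy|/eqP //].
by rewrite eqy (disjointFr disAB Ax') in By.
Qed.

Lemma min_degree_le (v : V) : (min_degree G <= #|G :&: star v|)%N.
Proof.
have -> : #|G :&: star v| = degree G v by apply: eq_card => e; rewrite !inE.
rewrite /min_degree; elim: (index_enum V) (mem_index_enum v) => // w t IHt.
by rewrite big_cons inE geq_min => /predU1P[<-|/IHt->]; rewrite ?leqnn ?orbT.
Qed.

Lemma sum_subsets_exp (K : finType) (D : {set K}) (s : R) :
  \sum_(B : {set K} | B \subset D) s ^+ #|B| = (1 + s) ^+ #|D|.
Proof.
transitivity (\prod_(a : K) ((if a \in D then s else 0) + 1)).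
  rewrite bigA_distr big_mkcond; apply: eq_bigr => B _; case: ifP => [/subsetP sBD|].
    rewrite -prodr_const big_mkcond; apply: eq_bigr => a _.
    by case: ifP => // /sBD ->.
  move/negbT/subsetPn => [a Ba nDa].
  by rewrite (bigD1 a) //= Ba (negbTE nDa) mul0r.
rewrite -prodr_const [RHS]big_mkcond; apply: eq_bigr => a _.
by case: ifP; rewrite ?add0r // addrC.
Qed.

(* The number of sets B of at most 11 k colours is bounded by summing
   s ^ (#|B| - 11 k) over all subsets B of the reserved set. *)
Lemma perturbed_prob_no_rainbow (k m : nat) (q1 q2 s : R) :
  (0 < k)%N -> (4 * k < #|V|)%N -> (m <= r)%N ->
  (#|V| + m)%:R / r%:R <= q1 <= 1 -> (11 * k + (r - m))%:R / r%:R <= q2 <= 1 ->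
  0 < s <= 1 ->
  pr (fun E c => ~~ has_rainbow_hamilton_cycle c) <=
  (2 ^ (#|V| + #|V| + r))%:R * (1 - p * (1 - q1)) ^+ (k * k) +
  #|V|%:R * ((s ^+ (11 * k))^-1 * (1 + s) ^+ m * q2 ^+ min_degree G).
Proof.
move=> k_gt0 lt_kV le_mr /andP[leq1 q1_le1] /andP[leq2 q2_le1] /andP[s_gt0 s_le1].
have rgt0 : 0 < r%:R :> R by rewrite ltr0n.
pose D0 := [set i in take m (enum 'I_r)].
have cardD0 : #|D0| = m.
  by rewrite cardsE (card_uniqP _) ?take_uniq ?enum_uniq // size_takel // size_enum_ord.
have /andP[p0 p1] := p01.
pose P1 (i : {set V} * {set V} * {set 'I_r}) :=
  [&& [disjoint i.1.1 & i.1.2], (k <= #|i.1.1|)%N, (k <= #|i.1.2|)%N & (#|i.2| <= #|V|)%N].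
pose B1 i := @coloured_in V r (between i.1.1 i.1.2) (i.2 :|: D0).
pose P2 (i : V * {set 'I_r}) := (i.2 \subset D0) && (#|i.2| <= 11 * k)%N.
pose B2 i := @coloured_in V r (star i.1) (i.2 :|: ~: D0).
pose A1 E c := [exists i, P1 i && B1 i E c].
pose A2 E c := [exists i, P2 i && B2 i E c].
apply: le_trans (@perturbed_prob_or _ A1 A2 _) _.
  move=> E c /(no_rainbow_obstruction D0 r_gt0 k_gt0 lt_kV).
  case=> [[A [B [D [dis leA leB leD cAB]]]]|[u [B [sub leB cu]]]]; apply/orP.
    by left; apply/existsP; exists (A, B, D); rewrite /P1 /= dis leA leB leD.
  by right; apply/existsP; exists (u, B); rewrite /P2 /= sub leB.
apply: lerD.
  apply: le_trans (@perturbed_prob_cover _ P1 A1 B1 _) _.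
    by move=> E c /existsP[i /andP[]]; exists i.
  have cardI : #|{: {set V} * {set V} * {set 'I_r}}| = (2 ^ (#|V| + #|V| + r))%N.
    have card_set (T : finType) : #|{: {set T}}| = (2 ^ #|T|)%N.
      by rewrite -[in RHS]cardsT -card_powerset powersetT cardsT.
    by rewrite !card_prod !card_set card_ord !expnD.
  rewrite -cardI mulr_natl -sumr_const big_mkcond; apply: ler_sum => -[[A B] D] _.
  have x0 : 0 <= 1 - p * (1 - q1).
    by rewrite subr_ge0 mulr_ile1 // ?subr_ge0 // gerBl (le_trans _ leq1) // divr_ge0 ?ler0n.
  case: ifP => [/and4P[/= dis leA leB leD]|_]; last exact: exprn_ge0.
  apply: (@le_trans _ _ ((1 - p * (1 - q1)) ^+ #|between A B|)).
    apply: perturbed_prob_coloured_in_random.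
    rewrite q1_le1 andbT (le_trans _ leq1) // ler_pM2r ?invr_gt0 // ler_nat.
    by apply: leq_trans (leq_card_setU _ _).1 _; rewrite cardD0 leq_add2r.
  apply: ler_wiXn2l => //; first by rewrite gerBl mulr_ge0 // subr_ge0.
  by apply: leq_trans (leq_card_between dis); apply: leq_mul.
apply: le_trans (@perturbed_prob_cover _ P2 A2 B2 _) _.
  by move=> E c /existsP[i /andP[]]; exists i.
have q2_ge0 : 0 <= q2 by rewrite (le_trans _ leq2) // divr_ge0 ?ler0n.
(* The size condition on [B] is traded for the weight, which is at least 1 when [#|B| <= 11 * k]
   because [s <= 1]. *)
apply: (@le_trans _ _ (\sum_(i : V * {set 'I_r} | i.2 \subset D0)
    s ^+ #|i.2| * ((s ^+ (11 * k))^-1 * q2 ^+ min_degree G))).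
  rewrite big_mkcond [leRHS]big_mkcond; apply: ler_sum => -[u B] _; rewrite /P2 /=.
  have rhs0 : 0 <= s ^+ #|B| * ((s ^+ (11 * k))^-1 * q2 ^+ min_degree G).
    by rewrite !mulr_ge0 ?invr_ge0 ?exprn_ge0 // ltW.
  case: (boolP (B \subset D0)) => //= subB; case: ifP => // leB.
  apply: (@le_trans _ _ (q2 ^+ #|G :&: star u|)).
    apply: perturbed_prob_coloured_in_fixed.
    rewrite q2_le1 andbT (le_trans _ leq2) // ler_pM2r ?invr_gt0 // ler_nat.
    apply: leq_trans (leq_card_setU _ _).1 _; apply: leq_add => //.
    by rewrite cardsCs setCK cardD0 card_ord.
  apply: (@le_trans _ _ (q2 ^+ min_degree G)).
    by apply: ler_wiXn2l => //; apply: min_degree_le.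
  rewrite mulrA ler_peMl ?exprn_ge0 //.
  by rewrite ler_pdivlMr ?exprn_gt0 // mul1r; apply: ler_wiXn2l => //; apply: ltW.
rewrite -mulr_suml -(pair_big_dep predT (fun _ (B : {set 'I_r}) => B \subset D0)
  (fun _ B => s ^+ #|B|)) /=.
rewrite sumr_const sum_subsets_exp cardD0.
set x := (1 + s) ^+ m; set y := _^-1; set z := q2 ^+ _.
by rewrite -(mulr_natl x) -mulrA (mulrCA x) [y * (x * z)]mulrA.
Qed.
End Probability.

(** * Asymptotics *)

Section Asymptotics.
Local Open Scope ring_scope.

Lemma exprn_le_expR (R : realType) (a b : R) (n : nat) :
  0 <= a -> a <= expR b -> a ^+ n <= expR (n%:R * b).
Proof. by move=> a0 ab; rewrite expRM_natl lerXn2r // nnegrE expR_ge0. Qed.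

(** By [2 <= expR 1] and [1 - x <= expR (- x)] the exponent is at most
    [(3 + alpha) * n - k * k * p * gamma], and the lower bound on [p] makes the subtracted term at
    least [(4 + alpha) * n]. *)
Lemma joined_failure_bound (R : realType) (alpha gamma kappa p : R) (n r k : nat) :
  0 < alpha -> 0 < gamma -> gamma < 1 -> 0 < kappa -> 0 <= p -> p <= 1 ->
  0 < n%:R :> R -> r%:R <= (1 + alpha) * n%:R -> kappa * n%:R <= k%:R ->
  (4 + alpha) / (gamma * kappa ^+ 2) / n%:R <= p ->
  (2 ^ (n + n + r))%:R * (1 - p * (1 - (1 - gamma))) ^+ (k * k) <= expR (- n%:R).
Proof.
move=> alpha_gt0 gamma_gt0 gamma1 kappa_gt0 p0 p1 n_gt0 r_le k_ge leCp.
have pgamma : 0 <= 1 - p * (1 - (1 - gamma)).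
  by rewrite subKr subr_ge0 mulr_ile1 // ltW.
have le2 : (2 ^ (n + n + r))%:R <= expR ((n + n + r)%:R * 1) :> R.
  by rewrite natrX; apply: exprn_le_expR; rewrite // (le_trans _ (expR_ge1Dx 1)).
have le3 : (1 - p * (1 - (1 - gamma))) ^+ (k * k) <= expR ((k * k)%:R * - (p * gamma)).
  by apply: exprn_le_expR; rewrite // subKr expR_ge1Dx.
apply: le_trans (ler_pM _ _ le2 le3) _ => //; first exact: exprn_ge0.
rewrite -expRD ler_expR mulr1 !natrD natrM.
have alpha4 : 0 <= 4 + alpha by rewrite addr_ge0 // ltW.
have kappa2 : 0 <= kappa ^+ 2 by rewrite exprn_ge0 // ltW.
have : (4 + alpha) * n%:R <= k%:R * k%:R * (p * gamma).
  have le_kk : (kappa * n%:R) * (kappa * n%:R) <= k%:R * k%:R.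
    by apply: ler_pM; rewrite // mulr_ge0 // ltW.
  have le_pg : (4 + alpha) / (kappa ^+ 2) / n%:R <= p * gamma.
    have -> : (4 + alpha) / kappa ^+ 2 / n%:R =
              (4 + alpha) / (gamma * kappa ^+ 2) / n%:R * gamma.
      by field; rewrite !gt_eqF.
    by rewrite ler_pM2r.
  apply: le_trans (ler_pM _ _ le_kk le_pg).
  - by rewrite le_eqVlt; apply/orP; left; apply/eqP; field; rewrite !gt_eqF.
  - by rewrite !mulr_ge0 // ltW.
  - by rewrite !divr_ge0.
by move: r_le; clear; rewrite mulrN; lra.
Qed.

(** The last factor gives exponent at most [- gamma * d * n]; each of the other two costs at most a
    quarter of that. *)
Lemma star_failure_bound (R : realType) (d alpha gamma L kappa : R) (n k m t : nat) :
  0 < d -> 0 < alpha -> 0 < gamma -> gamma < 1 -> L = 2 * alpha / (gamma * d) ->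
  kappa <= gamma * d / (88 * L) -> 88 * L / (gamma * d) < n%:R ->
  k%:R <= kappa * n%:R + 1 -> m%:R <= alpha * n%:R / 2 -> d * n%:R <= t%:R ->
  (expR (- L) ^+ (11 * k))^-1 * (1 + expR (- L)) ^+ m * (1 - gamma) ^+ t <=
  expR (- (gamma * d / 2 * n%:R)).
Proof.
move=> d_gt0 alpha_gt0 gamma_gt0 gamma1 def_L kappa_L n_L k_le m_le t_ge.
have gd_gt0 : 0 < gamma * d by exact: mulr_gt0.
have L_gt0 : 0 < L by rewrite def_L divr_gt0 // mulr_gt0.
have L88_gt0 : 0 < 88 * L by rewrite mulr_gt0.
have n_gt0 : 0 < n%:R :> R by apply: lt_trans n_L; rewrite divr_gt0.
have s_gt0 := expR_gt0 (- L).
have gamma1' : 0 <= 1 - gamma by rewrite subr_ge0 ltW.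
have s1 : 0 <= 1 + expR (- L) by rewrite addr_ge0 // ltW.
(* [L] is chosen so that [alpha / 2 = L * (gamma * d / 4)], and [expR (- L) * L <= 1]. *)
have expL : expR (- L) * (alpha / 2) <= gamma * d / 4.
  have le1 : expR (- L) * L <= 1.
    rewrite expRN mulrC ler_pdivrMr ?expR_gt0 // mul1r.
    by apply: le_trans (expR_ge1Dx L); rewrite lerDr.
  have -> : expR (- L) * (alpha / 2) = expR (- L) * L * (gamma * d / 4).
    by rewrite def_L; field; rewrite !gt_eqF.
  by rewrite ler_piMl // divr_ge0 // ltW.
have le2 : (expR (- L) ^+ (11 * k))^-1 = expR ((11 * k)%:R * L).
  by rewrite -expRM_natl -expRN mulrN opprK.
have le3 : (1 + expR (- L)) ^+ m <= expR (m%:R * expR (- L)).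
  by apply: exprn_le_expR; rewrite // expR_ge1Dx.
have le4 : (1 - gamma) ^+ t <= expR (t%:R * - gamma).
  by apply: exprn_le_expR; rewrite // expR_ge1Dx.
rewrite le2; apply: le_trans (ler_pM _ _ (ler_pM _ _ (lexx _) le3) le4) _.
- by rewrite mulr_ge0 ?expR_ge0 // exprn_ge0.
- exact: exprn_ge0.
- exact: expR_ge0.
- exact: exprn_ge0.
rewrite -!expRD ler_expR natrM.
(* The terms [kappa * n] and 1 in the bound on [k] cost one eighth each. *)
have e1 : 11%:R * k%:R * L <= gamma * d / 4 * n%:R.
  have le_kL : kappa * (88 * L) * n%:R <= gamma * d * n%:R.
    by rewrite ler_pM2r // -ler_pdivlMr.
  have le_L : 88 * L <= gamma * d * n%:R.
    by rewrite [leRHS]mulrC -ler_pdivrMr // ltW.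
  have : k%:R * L <= (kappa * n%:R + 1) * L by rewrite ler_pM2r.
  by move: le_kL le_L; clear; lra.
have e2 : m%:R * expR (- L) <= gamma * d / 4 * n%:R.
  apply: (@le_trans _ _ (expR (- L) * (alpha / 2) * n%:R)); last by rewrite ler_pM2r.
  by rewrite -mulrA mulrC ler_pM2l // mulrAC.
have e3 : gamma * (d * n%:R) <= gamma * t%:R by rewrite ler_pM2l.
by move: e1 e2 e3; clear; lra.
Qed.

Lemma perturbed_prob_no_rainbow_exp (R : realType) (d alpha gamma L kappa p : R)
    (n : nat) (G : sgraph 'I_n) :
  0 < d -> 0 < alpha -> gamma = alpha / (4 * (1 + alpha)) ->
  L = 2 * alpha / (gamma * d) ->
  0 < kappa -> kappa <= 8^-1 -> kappa <= alpha / 88 -> kappa <= gamma * d / (88 * L) ->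
  8 < n%:R :> R -> 96 / alpha < n%:R -> 88 * L / (gamma * d) < n%:R ->
  0 <= p <= 1 -> (4 + alpha) / (gamma * kappa ^+ 2) / n%:R <= p ->
  d * n%:R <= (min_degree G)%:R ->
  perturbed_prob p G (fun E (c : colouring E (Num.truncn ((1 + alpha) * n%:R))) =>
    ~~ has_rainbow_hamilton_cycle c) <=
  expR (- n%:R) + n%:R * expR (- (gamma * d / 2 * n%:R)).
Proof.
move=> d_gt0 alpha_gt0 def_gamma def_L kappa_gt0 kappa8 kappa_alpha kappa_L n8 n_alpha n_L.
move=> p01 leCp leG; have /andP[p0 p1] := p01.
have gamma_gt0 : 0 < gamma by rewrite def_gamma divr_gt0 //; lra.
have gammaE : gamma * (1 + alpha) = alpha / 4 by rewrite def_gamma; field; lra.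
have gamma1 : gamma < 1 by rewrite def_gamma ltr_pdivrMr; lra.
have gd_gt0 : 0 < gamma * d by exact: mulr_gt0.
have L_gt0 : 0 < L by rewrite def_L divr_gt0 //; lra.
set x := n%:R in n8 n_alpha n_L leCp leG *.
set r := Num.truncn _; pose m := Num.truncn (alpha * x / 2).
pose k := (Num.truncn (kappa * x)).+1.
have x_gt0 : 0 < x by lra.
have ax_gt0 : 0 < alpha * x by exact: mulr_gt0.
have kx_gt0 : 0 < kappa * x by exact: mulr_gt0.
have /andP[r_le r_gt] : r%:R <= (1 + alpha) * x < r.+1%:R.
  by apply: truncn_itv; nra.
have /andP[m_le m_gt] : m%:R <= alpha * x / 2 < m.+1%:R by apply: truncn_itv; lra.
have /andP[k_le k_gt] : (Num.truncn (kappa * x))%:R <= kappa * x < k%:R.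
  by apply: truncn_itv; lra.
have {}k_le : k%:R <= kappa * x + 1 by rewrite /k -natr1; lra.
rewrite -[r.+1%:R]natr1 in r_gt; rewrite -[m.+1%:R]natr1 in m_gt.
have ax96 : 96 < alpha * x by move: n_alpha; rewrite ltr_pdivrMr // mulrC.
have kx8 : kappa * x <= x / 8 by rewrite mulrC ler_pM2l //; lra.
have kxa : kappa * x <= alpha * x / 88 by rewrite mulrAC ler_pM2r.
have r_gt0 : 0 < r%:R :> R by lra.
have le_mr : (m <= r)%N by rewrite -(ler_nat R); lra.
have := @perturbed_prob_no_rainbow R 'I_n p G r p01 _ k m (1 - gamma) (1 - gamma) (expR (- L)).
rewrite card_ord => /(_ _ _ _ le_mr) bound.
apply: le_trans (bound _ _ _ _ _ _) _ => {bound} //.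
- by rewrite -(ltr_nat R).
(* [4 * k <= x / 2 + 4 < x], by [kappa <= 1 / 8] and [x > 8]. *)
- by rewrite -(ltr_nat R) natrM -/x; lra.
- rewrite ler_pdivrMr // natrD -/x; apply/andP; split; last by lra.
  have : gamma * r%:R <= gamma * ((1 + alpha) * x) by rewrite ler_pM2l.
  by rewrite mulrA gammaE; lra.
(* This amounts to [11 * k + gamma * r <= m]. The left side is at most [3 / 8 * alpha * x + 11] and
   [m > alpha * x / 2 - 1], whence the threshold 96. *)
- rewrite ler_pdivrMr // natrD natrM natrB //; apply/andP; split; last by lra.
  have : gamma * r%:R <= gamma * ((1 + alpha) * x) by rewrite ler_pM2l.
  by rewrite mulrA gammaE; lra.
- by rewrite expR_gt0 /= -[leRHS]expR0 ler_expR; lra.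
apply: lerD.
  by apply: (@joined_failure_bound R alpha gamma kappa) => //; exact: ltW.
by rewrite ler_pM2l //; apply: (@star_failure_bound R d alpha gamma L kappa).
Qed.


(** Squaring [c * n / 2 <= expR (c * n / 2)] gains the extra power of [n] that beats the factor
    [n]. *)
Lemma expR_failure_bound (R : realType) (c : R) (n : nat) :
  0 < c -> 0 < n%:R :> R ->
  expR (- n%:R) + n%:R * expR (- (c * n%:R)) <= (1 + 4 / c ^+ 2) / n%:R.
Proof.
move=> c_gt0 n_gt0; rewrite mulrDl; apply: lerD.
  rewrite mul1r expRN lef_pV2 ?posrE ?expR_gt0 //.
  by apply: le_trans (expR_ge1Dx _); rewrite lerDr.
have le1 : c * n%:R / 2 <= expR (c * n%:R / 2).
  by apply: le_trans (expR_ge1Dx _); rewrite lerDr.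
have cn_gt0 : 0 < c * n%:R / 2 by rewrite divr_gt0 // mulr_gt0.
have le2 : (c * n%:R / 2) ^+ 2 <= expR (c * n%:R).
  have -> : expR (c * n%:R) = expR (c * n%:R / 2) ^+ 2.
    by rewrite -expRM_natl; congr expR; field.
  by apply: lerXn2r; rewrite // nnegrE ?expR_ge0 // ltW.
have -> : 4 / c ^+ 2 / n%:R = n%:R * ((c * n%:R / 2) ^+ 2)^-1.
  by field; rewrite !gt_eqF.
by rewrite ler_pM2l // expRN lef_pV2 ?posrE ?expR_gt0 // exprn_gt0.
Qed.

End Asymptotics.

(** * Choice of the constants and passage to the limit *)

Local Open Scope classical_set_scope.
Local Open Scope ring_scope.

Theorem theorem1p1 (R : realType) (d alpha : R) (d_gt0 : 0 < d)
    (alpha_gt0 : 0 < alpha) :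
  exists2 C : R, 0 < C &
    forall (p : nat -> R) (G : forall n : nat, sgraph 'I_n),
      (forall n : nat, 0 <= p n <= 1) ->
      (\forall n \near \oo, C / n%:R <= p n) ->
      (\forall n \near \oo, d * n%:R <= (min_degree (G n))%:R) ->
      perturbed_prob (p n) (G n)
        (@has_rainbow_hamilton_cycle 'I_n (Num.truncn ((1 + alpha) * n%:R)))
        @[n --> \oo] --> (1 : R).
Proof.
pose gamma := alpha / (4 * (1 + alpha)); pose L := 2 * alpha / (gamma * d).
(* In order, the three bounds serve [4 * k < n], the room for [11 * k] colours inside the reserve,
   and the star estimate. *)
pose kappa := Num.min 8^-1 (Num.min (alpha / 88) (gamma * d / (88 * L))).
have gamma_gt0 : 0 < gamma by rewrite divr_gt0 // mulr_gt0 // addr_gt0.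
have gd_gt0 : 0 < gamma * d by exact: mulr_gt0.
have L_gt0 : 0 < L by rewrite divr_gt0 // mulr_gt0.
have kappa_gt0 : 0 < kappa by rewrite /kappa !lt_min invr_gt0 ltr0n !divr_gt0 // mulr_gt0.
exists ((4 + alpha) / (gamma * kappa ^+ 2)).
  by rewrite divr_gt0 ?addr_gt0 // mulr_gt0 // exprn_gt0.
move=> p G p01 near_p near_d.
apply/cvgrPdist_le => e e_gt0; near=> n.
have n8 : 8 < n%:R :> R by near: n; exact: nbhs_infty_gtr.
have n_gt0 : 0 < n%:R :> R by apply: lt_trans n8.
have r_gt0 : (0 < Num.truncn ((1 + alpha) * n%:R))%N.
  rewrite truncn_gt0 mulrDl mul1r; apply: (@le_trans _ _ n%:R).
    by apply: ltW; apply: lt_trans n8; rewrite ltr1n.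
  by rewrite lerDl mulr_ge0 // ltW.
rewrite [X in 1 - X]perturbed_prob_not // subKr ger0_norm; last first.
  exact: perturbed_prob_ge0.
apply: le_trans (perturbed_prob_no_rainbow_exp (d := d) (alpha := alpha)
  (gamma := gamma) (L := L) (kappa := kappa) _ _ _ _ _ _ _ _ _ _ _ _ _ _) _ => //.
- by rewrite ge_min lexx.
- by rewrite !ge_min lexx orbT.
- by rewrite !ge_min lexx !orbT.
- by near: n; exact: nbhs_infty_gtr.
- by near: n; exact: nbhs_infty_gtr.
- by near: n.
- by near: n.
apply: le_trans (expR_failure_bound _ n_gt0) _; first by rewrite divr_gt0.
(* The failure probability is at most a constant over [n], hence at most [e] once [n] exceeds that
   constant divided by [e]. *)
rewrite ler_pdivrMr // [leRHS]mulrC -ler_pdivrMr //; apply: ltW.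
by near: n; exact: nbhs_infty_gtr.
Unshelve. all: by end_near.
Qed.
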